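(* Let $P\subset\mathbb{R}^2$ be a centrally symmetric $2n$-gon with vertices $v_1,\dots,v_{2n}$. Then the bisection fan of $P$ is the complete polyhedral fan $\Delta$ in $\mathbb{R}^2$ whose rays are generated by the vectors $v_i-v_j$ for all $i,j\in\{1,\dots,2n\}$, $i\neq j$.
   Context: $P=-P$ is a full-dimensional convex polygon in $\mathbb{R}^2$. Its distance function is $\operatorname{dist}(a,b)=\min\{\alpha\ge 0 : b-a\in\alpha P\}$. The bisector is $\operatorname{bis}(a,b)=\{x\in\mathbb{R}^2:\operatorname{dist}(a,x)=\operatorname{dist}(b,x)\}$. For a facet (edge) $F$ of $P$, $C_F=\operatorname{cone}(F)$. For facets $F,G$, $\operatorname{bis}_{F,G}(a,b)=\operatorname{bis}(a,b)\cap(C_F+a)\cap(C_G+b)$. Two bisectors $\operatorname{bis}(a,b)$ and $\operatorname{bis}(a',b')$ are equivalent if for all facets $F,G$ of $P$: $\operatorname{bis}_{F,G}(a,b)\ne\emptyset \Leftrightarrow \operatorname{bis}_{F,G}(a',b')\neq\emptyset$. A point $c\in\mathbb{R}^2$ is in general position if there is a neighborhood $U$ of $c$ such that $\operatorname{bis}(0,c)$ is equivalent to $\operatorname{bis}(0,c')$ for all $c'\in U$. A polyhedral fan $\Delta$ is the bisection fan of $P$ if for all $a,b\in\mathbb{R}^2$ in general position the following are equivalent: (i) $\operatorname{bis}(0,a)$ and $\operatorname{bis}(0,b)$ are equivalent; (ii) $a$ and $b$ lie in the interior of the same maximal cone of $\Delta$. *)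

(* Defs.v *)
From HB Require Import structures.
From mathcomp Require Import all_boot all_order all_algebra.
From mathcomp Require Import all_classical all_reals all_analysis.

Set Implicit Arguments.
Unset Strict Implicit.
Unset Printing Implicit Defensive.

Import Order.TTheory GRing.Theory Num.Theory.
Import numFieldNormedType.Exports.

Local Open Scope classical_set_scope.
Local Open Scope ring_scope.

Section Convexity.
Variable R : realType.
Local Notation plane := 'rV[R]_2.

Definition dot (u x : plane) : R := (u *m x^T) 0 0.

Definition conv_hull (A : set plane) : set plane :=
  smallest (@convex_set R plane) A.

(* The empty combination is allowed, so 0 always belongs to [cone A]. *)
Definition cone (A : set plane) : set plane :=
  [set x | exists k (t : 'I_k -> R) (y : 'I_k -> plane),
     [/\ forall i, 0 <= t i, forall i, A (y i) & x = \sum_i t i *: y i]].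

(* [D] is, as a row space, the direction space of the affine hull of [A]. *)
Definition has_dim (A : set plane) (k : nat) : Prop :=
  A !=set0 /\
  exists D : 'M[R]_2,
    [/\ \rank D = k,
        forall x y, A x -> A y -> (x - y <= D)%MS
      & forall E : 'M[R]_2,
          (forall x y, A x -> A y -> (x - y <= E)%MS) -> (D <= E)%MS].

(* Nonempty faces only; [u = 0] gives [K] itself. When [K] is a cone, the
   maximum of [dot u] over [K], if attained, is 0. *)
Definition face (K F : set plane) : Prop :=
  F !=set0 /\
  exists u : plane, F = [set x | K x /\ forall y, K y -> dot u y <= dot u x].

Definition facet (P F : set plane) : Prop := face P F /\ has_dim F 1.

Definition vertices (P : set plane) : set plane := [set x | face P [set x]].

Definition polygon_with_vertices (I : finType) (P : set plane)
    (v : I -> plane) : Prop :=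
  [/\ injective v, P = conv_hull (range v), vertices P = range v
    & has_dim P 2].

Definition centrally_symmetric (P : set plane) : Prop := P = -%R @` P.

Definition polyhedral_cone (C : set plane) : Prop :=
  exists s : seq plane, C = [set x | forall u, u \in s -> 0 <= dot u x].

Definition polyhedral_fan (Delta : set (set plane)) : Prop :=
  [/\ finite_set Delta,
      forall C, Delta C -> polyhedral_cone C,
      forall C F, Delta C -> face C F -> Delta F
    & forall C D, Delta C -> Delta D ->
        face C (C `&` D) /\ face D (C `&` D)].

Definition complete_fan (Delta : set (set plane)) : Prop :=
  \bigcup_(C in Delta) C = setT.

Definition rays (Delta : set (set plane)) : set (set plane) :=
  [set C | Delta C /\ has_dim C 1].

Definition maximal_cone (Delta : set (set plane)) (C : set plane) : Prop :=
  Delta C /\ forall D, Delta D -> C `<=` D -> D = C.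

End Convexity.

Section Bisectors.
Variables (R : realType) (P : set 'rV[R]_2).
Local Notation plane := 'rV[R]_2.

(* For a symmetric full-dimensional polygon the infimum is a minimum. *)
Definition dist (a b : plane) : R :=
  inf [set t : R | 0 <= t /\ exists2 p, P p & b - a = t *: p].

Definition bis (a b : plane) : set plane := [set x | dist a x = dist b x].

Definition bis_facets (F G : set plane) (a b : plane) : set plane :=
  bis a b `&` [set x + a | x in cone F] `&` [set x + b | x in cone G].

Definition bis_equiv (a b a' b' : plane) : Prop :=
  forall F G, facet P F -> facet P G ->
    (bis_facets F G a b !=set0 <-> bis_facets F G a' b' !=set0).

Definition general_position (c : plane) : Prop :=
  \forall c' \near c, bis_equiv 0 c 0 c'.

Definition bisection_fan (Delta : set (set plane)) : Prop :=
  polyhedral_fan Delta /\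
  forall a b, general_position a -> general_position b ->
    (bis_equiv 0 a 0 b <->
     exists C, [/\ maximal_cone Delta C, interior C a & interior C b]).

End Bisectors.

(* Main.v *)
(* Write K(F,G) = {l (x - y) : l >= 0, x in F, y in G} for edges F, G of P. A
   point z of a + cone(F) is at distance l from a exactly when z = a + l p with
   p in F, so bis_{F,G}(0,a) is nonempty iff a lies in K(F,G), and bis(0,a) is
   determined up to equivalence by the pairs with a in K(F,G).

   The fan Delta is that of the arrangement of lines spanned by the v_i - v_j:
   its cones are the intersections of the closed half-planes, bounded by these
   lines, that contain a given point. A cone K(F,G) is generated by vectors
   v_i - v_j, so it does not separate two points in the same open cell.
   Conversely, every w = v_i - v_j has, on each side of its line, a cone K(F,G)
   lying on that side and having w on its boundary: take for F the edge at v_i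
   rising away from the line, and for G the edge at v_j descending from it.
   Applied to the two walls of the cell of a generic a, this confines every b
   with bis(0,b) equivalent to bis(0,a) to that cell; it also shows that no
   point on a ray of Delta is in general position. *)

Require Import Defs.
From HB Require Import structures.
From mathcomp Require Import all_boot all_order all_algebra.
From mathcomp Require Import all_classical all_reals all_analysis.
From mathcomp Require Import ring lra.

Set Implicit Arguments.
Unset Strict Implicit.
Unset Printing Implicit Defensive.

Import Order.TTheory GRing.Theory Num.Theory.
Import numFieldNormedType.Exports.

Local Open Scope classical_set_scope.
Local Open Scope ring_scope.

(** * Linear algebra in the plane: determinants, dimension, small perturbations *)

Section Plane.
Variable R : realType.
Local Notation plane := 'rV[R]_2.
Implicit Types (u x y z : plane) (c : R).

Definition det2 x y : R := x 0 0 * y 0 1 - x 0 1 * y 0 0.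

(** Quarter turn, which turns [det2 x] into a functional of the form [dot u]. *)
Definition rot x : plane := \row_j (if j == 0 then - x 0 1 else x 0 0).

Definition ray x : set plane := [set y | exists2 c, 0 <= c & y = c *: x].

Lemma planeP x y : x 0 0 = y 0 0 -> x 0 1 = y 0 1 -> x = y.
Proof.
move=> h0 h1; apply/rowP => i.
have [->|->] : i = 0 \/ i = 1; last 2 first.
- exact: h0.
- exact: h1.
by case: i => -[|[|//]] ?; [left|right]; apply/val_inj.
Qed.

Lemma dotE u x : dot u x = u 0 0 * x 0 0 + u 0 1 * x 0 1.
Proof.
rewrite /dot mxE big_ord_recl big_ord1 !mxE.
by rewrite (_ : lift ord0 ord0 = 1) //; apply/val_inj.
Qed.

Lemma dotC u x : dot u x = dot x u.
Proof. by rewrite !dotE; ring. Qed.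

Lemma dotDr u x y : dot u (x + y) = dot u x + dot u y.
Proof. by rewrite !dotE !mxE; ring. Qed.

Lemma dotBr u x y : dot u (x - y) = dot u x - dot u y.
Proof. by rewrite !dotE !mxE; ring. Qed.

Lemma dotNr u x : dot u (- x) = - dot u x.
Proof. by rewrite !dotE !mxE; ring. Qed.

Lemma dotZr u c x : dot u (c *: x) = c * dot u x.
Proof. by rewrite !dotE !mxE; ring. Qed.

Lemma dot0r u : dot u 0 = 0.
Proof. by rewrite !dotE !mxE; ring. Qed.

Lemma dot_sumr (I : Type) (r : seq I) (Q : pred I) u (f : I -> plane) :
  dot u (\sum_(i <- r | Q i) f i) = \sum_(i <- r | Q i) dot u (f i).
Proof.
exact: (big_morph (dot u) (dotDr u) (dot0r u)).
Qed.

Lemma dotDl u x y : dot (x + y) u = dot x u + dot y u.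
Proof. by rewrite !(dotC _ u) dotDr. Qed.

Lemma dotNl u x : dot (- x) u = - dot x u.
Proof. by rewrite !(dotC _ u) dotNr. Qed.

Lemma dotZl u c x : dot (c *: x) u = c * dot x u.
Proof. by rewrite !(dotC _ u) dotZr. Qed.

Lemma dot0l u : dot 0 u = 0.
Proof. by rewrite dotC dot0r. Qed.

Lemma dot_suml (I : Type) (r : seq I) (Q : pred I) u (f : I -> plane) :
  dot (\sum_(i <- r | Q i) f i) u = \sum_(i <- r | Q i) dot (f i) u.
Proof. by rewrite dotC dot_sumr; under eq_bigr do rewrite dotC. Qed.

Lemma dot_rot x y : dot (rot x) y = det2 x y.
Proof. by rewrite dotE /det2 !mxE /=; ring. Qed.

Lemma det2N x y : det2 y x = - det2 x y.
Proof. by rewrite /det2; ring. Qed.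

Lemma det2xx x : det2 x x = 0.
Proof. by rewrite /det2; ring. Qed.

Lemma det2Dr x y z : det2 x (y + z) = det2 x y + det2 x z.
Proof. by rewrite -!dot_rot dotDr. Qed.

Lemma det2Br x y z : det2 x (y - z) = det2 x y - det2 x z.
Proof. by rewrite -!dot_rot dotBr. Qed.

Lemma det2Zr x c y : det2 x (c *: y) = c * det2 x y.
Proof. by rewrite -!dot_rot dotZr. Qed.

Lemma det2Nr x y : det2 x (- y) = - det2 x y.
Proof. by rewrite -!dot_rot dotNr. Qed.

Lemma det2x0 x : det2 x 0 = 0.
Proof. by rewrite -!dot_rot dot0r. Qed.

Lemma det2Nl x y : det2 (- x) y = - det2 x y.
Proof. by rewrite det2N det2Nr -det2N. Qed.

Lemma det2Zl c x y : det2 (c *: x) y = c * det2 x y.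
Proof. by rewrite det2N det2Zr det2N; ring. Qed.

Lemma det20x x : det2 0 x = 0.
Proof. by rewrite det2N det2x0 oppr0. Qed.

Lemma det2_sumr (I : Type) (r : seq I) (Q : pred I) x (f : I -> plane) :
  det2 x (\sum_(i <- r | Q i) f i) = \sum_(i <- r | Q i) det2 x (f i).
Proof. by rewrite -dot_rot dot_sumr; under eq_bigr do rewrite dot_rot. Qed.

Lemma dot_gt0 x : x != 0 -> 0 < dot x x.
Proof.
move=> x0; rewrite lt_def dotE -!expr2 addr_ge0 ?sqr_ge0 // andbT.
apply: contra x0; rewrite paddr_eq0 ?sqr_ge0 // !sqrf_eq0.
by move=> /andP[/eqP h0 /eqP h1]; apply/eqP/planeP; rewrite !mxE.
Qed.

Lemma dot_neq0 x : x != 0 -> dot x x != 0.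
Proof. by move/dot_gt0; rewrite lt0r => /andP[]. Qed.

Lemma rot_eq0 x : (rot x == 0) = (x == 0).
Proof.
apply/eqP/eqP => [h|->]; last by apply: planeP; rewrite !mxE /= ?oppr0.
apply: planeP; rewrite [RHS]mxE.
- by have := congr1 (fun y : plane => y 0 1) h; rewrite !mxE.
- have /eqP := congr1 (fun y : plane => y 0 0) h.
  by rewrite !mxE oppr_eq0 => /eqP.
Qed.

Lemma delta_mx0_neq0 : (delta_mx 0 0 : plane) != 0.
Proof.
by apply/eqP => /matrixP/(_ 0 0)/eqP; rewrite !mxE oner_eq0.
Qed.

Lemma cramer x y z : det2 x y *: z = det2 z y *: x + det2 x z *: y.
Proof. by apply: planeP; rewrite !mxE /det2; ring. Qed.

Lemma cramerV x y z : det2 x y != 0 ->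
  z = (det2 z y / det2 x y) *: x + (det2 x z / det2 x y) *: y.
Proof.
move=> d0; apply: (scalerI d0); rewrite cramer scalerDr !scalerA.
by congr (_ *: _ + _ *: _); rewrite mulrCA divff ?mulr1.
Qed.

(** When [det2 a x] and [det2 a y] have the same sign, this reads the sign of [det2 x y] off a
    comparison of the cotangents of the angles from [a]. *)
Lemma det2_lagrange a x y :
  dot a a * det2 x y = dot a x * det2 a y - dot a y * det2 a x.
Proof. by rewrite !dotE /det2; ring. Qed.

Lemma det2_eq0 x y : x != 0 -> det2 x y = 0 -> y = (dot x y / dot x x) *: x.
Proof.
move=> x0 d0; have xx := dot_neq0 x0.
apply: (scalerI xx); rewrite scalerA mulrCA divff ?mulr1 //.
move: d0; rewrite /det2 => /eqP; rewrite subr_eq0 => /eqP d0.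
by apply: planeP; rewrite !mxE !dotE; ring: d0.
Qed.

Lemma dot_det2_eq0 u x y : u != 0 -> dot u x = 0 -> dot u y = 0 ->
  det2 x y = 0.
Proof.
move=> u0 hx hy; have := det2_lagrange u x y; rewrite hx hy !mul0r subrr.
by move/eqP; rewrite mulf_eq0 (negbTE (dot_neq0 u0)) => /eqP.
Qed.

Lemma cone_set1 x : cone [set x] = ray x.
Proof.
apply/seteqP; split => y /=.
- move=> [k [t [z [t0 zx ->]]]]; exists (\sum_i t i).
    by apply: sumr_ge0 => i _; exact: t0.
  by rewrite scaler_suml; apply: eq_bigr => i _; rewrite (zx i).
- move=> [c c0 ->]; exists 1%N, (fun=> c), (fun=> x); split => //.
  by rewrite big_ord1.
Qed.

Lemma has_dim1I (A : set plane) x y : A x -> A y -> x != y ->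
  (forall a b, A a -> A b -> det2 (x - y) (a - b) = 0) -> has_dim A 1.
Proof.
move=> Ax Ay xy par; have xy0 : x - y != 0 by rewrite subr_eq0.
split; first by exists x.
exists <<x - y>>%MS; split.
- by rewrite mxrank_gen rank_rV xy0.
- move=> a b Aa Ab; rewrite genmxE; apply/sub_rVP.
  by eexists; apply: det2_eq0 => //; exact: par.
- by move=> E hE; rewrite genmxE; exact: hE.
Qed.

Lemma has_dim1_det2 (A : set plane) x y z t : has_dim A 1 ->
  A x -> A y -> A z -> A t -> det2 (x - y) (z - t) = 0.
Proof.
move=> [_ [D [rD sD _]]] Ax Ay Az At.
have [->|xy0] := eqVneq (x - y) 0; first by rewrite det20x.
have hD : (D <= (x - y)%R)%MS.
  have := mxrank_leqif_sup (sD x y Ax Ay).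
  by rewrite rank_rV xy0 rD => -[_ <-].
have /sub_rVP[c ->] := submx_trans (sD z t Az At) hD.
by rewrite det2Zr det2xx mulr0.
Qed.

Lemma has_dim1_neq (A : set plane) : has_dim A 1 ->
  exists x y, [/\ A x, A y & x != y].
Proof.
move=> [_ [D [rD _ mD]]]; apply: contrapT => h.
have : (D <= (0 : 'M[R]_2))%MS.
  apply: mD => x y Ax Ay; have [->|xy] := eqVneq x y.
    by rewrite subrr sub0mx.
  by exfalso; apply: h; exists x, y.
by rewrite submx0 => /eqP D0; move: rD; rewrite D0 mxrank0.
Qed.

(** Otherwise all differences lie in the kernel of [u], of rank 1, and by minimality so does the
    direction space, of rank 2. *)
Lemma has_dim2_dot (A : set plane) u : has_dim A 2 -> u != 0 ->
  exists x y, [/\ A x, A y & dot u (x - y) != 0].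
Proof.
move=> [_ [D [rD _ mD]]] u0; apply: contrapT => h.
have : (D <= kermx (u^T))%MS.
  apply: mD => x y Ax Ay; apply/sub_kermxP.
  apply/matrixP => i j; rewrite !ord1 [RHS]mxE.
  have [e|ne] := eqVneq (dot u (x - y)) 0; first by rewrite dotC in e.
  by exfalso; apply: h; exists x, y.
move/mxrankS; rewrite mxrank_ker mxrank_tr rank_rV u0 rD.
by [].
Qed.

Lemma nbhs_dir x y (A : set plane) : nbhs x A ->
  exists2 e : R, 0 < e & A (x + e *: y).
Proof.
move=> nA.
have cf : (fun e : R => x + e *: y) @ (0 : R) --> x + (0 : R) *: y.
  by apply: cvgD; [exact: cvg_cst|apply: cvgZr_tmp; exact: cvg_id].
rewrite scale0r addr0 in cf.
have /nbhs_ballP[e /= e0 he] := cf _ nA.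
exists (e / 2); first by rewrite divr_gt0.
apply: he; rewrite -ball_normE /= sub0r normrN gtr0_norm ?divr_gt0 //.
by lra.
Qed.

Lemma dot_continuous u : continuous (dot u).
Proof.
move=> x; have -> : dot u = fun y => u 0 0 * y 0 0 + u 0 1 * y 0 1.
  by apply/funext => y; rewrite dotE.
have c j : (fun y : plane => u 0 j * y 0 j) @ x --> u 0 j * x 0 j.
  apply: (@cvgM R plane (nbhs x) _ (fun=> u 0 j) (fun y : plane => y 0 j)).
    exact: cvg_cst.
  by move=> A hA; exact: (@coord_continuous R 1 2 0 j x A hA).
exact: cvgD (c 0) (c 1).
Qed.

Lemma nbhs_dot_gt0 (T : finType) (Q : pred T) (f : T -> plane) x :
  (forall k, Q k -> 0 < dot (f k) x) ->
  nbhs x [set y | forall k, Q k -> 0 < dot (f k) y].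
Proof.
move=> h; apply: (@filter_forall plane T
  (fun k => [set y | Q k -> 0 < dot (f k) y]) (nbhs x)) => k.
have [Qk|nQk] := boolP (Q k); last by apply: filterE.
have : nbhs (dot (f k) x) [set t | 0 < t].
  by apply: open_nbhs_nbhs; split; [exact: open_gt|exact: h].
move=> hA; have hx := @dot_continuous (f k) x _ hA.
by apply: (@filterS plane (nbhs x) _ _ _ _ hx) => y hy _; exact: hy.
Qed.

(* With the convention [x / 0 = 0] the sum ranges over the [f k != 0]. *)
Lemma small_factor (T : finType) (f g : T -> R) :
  (forall k, 0 <= f k) -> (forall k, f k = 0 -> g k = 0) ->
  exists2 e, 0 < e & forall k, e * `|g k| <= f k.
Proof.
move=> f0 fg; pose s := 1 + \sum_k `|g k| / f k.
have t0 k : 0 <= `|g k| / f k by rewrite divr_ge0.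
have s0 : 0 < s by rewrite ltr_pwDl // sumr_ge0.
exists s^-1; first by rewrite invr_gt0.
move=> k; have [fk|fk] := eqVneq (f k) 0; first by rewrite fg // normr0 mulr0.
rewrite mulrC ler_pdivrMr // mulrC -ler_pdivrMr ?lt_def ?fk ?f0 //.
by rewrite /s (bigD1 k) //= addrCA lerDl addr_ge0 // sumr_ge0.
Qed.

End Plane.

(** * The fan of an arrangement of lines through the origin *)

Section Arrangement.
Variables (R : realType) (T : finType) (w : T -> 'rV[R]_2).
Hypothesis w_neq0 : forall k, w k != 0.
Hypothesis w_opp : forall k, exists k', w k' = - w k.
Hypothesis w_span : forall u, u != 0 -> exists k, dot u (w k) != 0.
Local Notation plane := 'rV[R]_2.
Implicit Types (u x y z : plane) (c : R).

(** As the family is closed under negation, the condition [0 <=] also records the negative sides,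
    and a line through [x] is kept as an equality. *)
Definition cell x : set plane :=
  [set y | forall k, 0 <= det2 (w k) x -> 0 <= det2 (w k) y].

Definition generic x := forall k, det2 (w k) x != 0.

Definition arrangement_fan : set (set plane) := range cell.

Lemma cell_refl x : cell x x.
Proof. by move=> k. Qed.

Lemma cell_trans x y : cell x y -> cell y `<=` cell x.
Proof. by move=> xy z yz k /xy /yz. Qed.

Lemma cell_le0 x y k : cell x y -> det2 (w k) x <= 0 -> det2 (w k) y <= 0.
Proof.
have [k' ek] := w_opp k; move=> /(_ k'); rewrite ek !det2Nl !oppr_ge0.
exact.
Qed.

Lemma cell_eq0 x y k : cell x y -> det2 (w k) x = 0 -> det2 (w k) y = 0.
Proof.
move=> xy h; apply/eqP; rewrite eq_le (cell_le0 xy) ?h //=.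
by apply: xy; rewrite h.
Qed.

Lemma cell0r x : cell x 0.
Proof. by move=> k _; rewrite det2x0. Qed.

Lemma cellD x y z : cell x y -> cell x z -> cell x (y + z).
Proof. by move=> xy xz k h; rewrite det2Dr addr_ge0 ?xy ?xz. Qed.

Lemma cellZ x c y : 0 <= c -> cell x y -> cell x (c *: y).
Proof. by move=> c0 xy k h; rewrite det2Zr mulr_ge0 ?xy. Qed.

Lemma cell_scale c x : 0 < c -> cell (c *: x) = cell x.
Proof.
move=> c0; apply/seteqP; split; apply: cell_trans.
  by apply: cellZ; [exact: ltW|exact: cell_refl].
by move=> k; rewrite det2Zr pmulr_rge0.
Qed.

Lemma w_det2_neq0 x : x != 0 -> exists k, det2 (w k) x != 0.
Proof.
rewrite -rot_eq0 => /w_span[k]; rewrite dot_rot => h; exists k.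
by rewrite det2N oppr_eq0.
Qed.

Lemma w_det2_gt0 x : x != 0 -> exists k, 0 < det2 (w k) x.
Proof.
move=> /w_det2_neq0[k]; have [k' ek] := w_opp k.
by case: ltgtP => // h _; [exists k'; rewrite ek det2Nl oppr_gt0|exists k].
Qed.

(** The line of [w k] confines the cell to multiples of [w k]; another vector of the family, not
    parallel to it, excludes the negative ones. *)
Lemma cell_w k : cell (w k) = ray (w k).
Proof.
apply/seteqP; split => y.
- move=> ky; have /(det2_eq0 (w_neq0 k)) := cell_eq0 ky (det2xx (w k)).
  move: (_ / _) => c ey; exists c => //.
  have [l l0] := w_det2_gt0 (w_neq0 k).
  have := ky l (ltW l0); rewrite ey det2Zr pmulr_lge0 //.
- by move=> [c c0 ->]; apply: cellZ => //; exact: cell_refl.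
Qed.

Lemma cell0 : cell 0 = [set 0].
Proof.
apply/seteqP; split => y; last by move=> ->; exact: cell_refl.
move=> h; apply: contrapT => /eqP /w_det2_neq0[k /negP]; apply.
by apply/eqP; apply: cell_eq0 h _; rewrite det2x0.
Qed.

Lemma ray_of_det2_eq0 x k : x != 0 -> det2 (w k) x = 0 ->
  exists l c, 0 < c /\ x = c *: w l.
Proof.
move=> x0 /(det2_eq0 (w_neq0 k)); move: (_ / _) => c ex.
have c0 : c != 0 by apply: contra x0 => /eqP h; rewrite ex h scale0r.
have [k' ek] := w_opp k.
move: c0; rewrite neq_lt => /orP[c0|c0]; last by exists k, c.
by exists k', (- c); rewrite oppr_gt0 ek scalerN scaleNr opprK.
Qed.

Lemma nongeneric_ray x k : det2 (w k) x = 0 -> exists l, ray (w l) x.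
Proof.
move=> h; have [->|x0] := eqVneq x 0; first by exists k, 0; rewrite ?scale0r.
have [l [c [c0 ->]]] := ray_of_det2_eq0 x0 h.
by exists l, c; rewrite // ltW.
Qed.

Lemma genericI x y :
  (forall k, 0 <= det2 (w k) x -> 0 < det2 (w k) y) -> generic y.
Proof.
move=> pos k; have [/pos|/ltW hk] := leP 0 (det2 (w k) x).
  by rewrite lt0r => /andP[].
have [k' ek] := w_opp k; have := pos k'.
by rewrite ek !det2Nl oppr_ge0 oppr_gt0 => /(_ hk) /ltr0_neq0.
Qed.

Lemma generic_ray x k : generic x -> ~ ray (w k) x.
Proof.
by move=> gx [c _ e]; have := gx k; rewrite e det2Zr det2xx mulr0 eqxx.
Qed.

Lemma generic_eps x y : generic x -> exists2 e, 0 < e & cell x (x + e *: y).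
Proof.
move=> gx.
have [k|k /normr0P h|e e0 he] :=
    small_factor (f := fun k => `|det2 (w k) x|) (g := fun k => det2 (w k) y).
- exact: normr_ge0.
- by have := gx k; rewrite (eqP h) eqxx.
exists e => // k h; have := he k; rewrite (ger0_norm h) det2Dr det2Zr.
rewrite -{1}(gtr0_norm e0) -normrM ler_norml => /andP[+ _].
by rewrite -subr_ge0 opprK addrC.
Qed.

Lemma generic_dim x : generic x -> ~ has_dim (cell x) 1.
Proof.
move=> gx h.
have [e e0 he] := generic_eps (delta_mx 0 0) gx.
have [d d0 hd] := generic_eps (delta_mx 0 1) gx.
have := has_dim1_det2 h he (@cell_refl x) hd (@cell_refl x).
have -> : det2 (x + e *: delta_mx 0 0 - x) (x + d *: delta_mx 0 1 - x) = e * d.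
  by rewrite /det2 !mxE /=; ring.
by move/eqP; rewrite mulf_eq0 !gt_eqF.
Qed.

Lemma ray_dim k : has_dim (ray (w k)) 1.
Proof.
apply: (@has_dim1I _ _ (w k) 0).
- by exists 1; rewrite ?scale1r.
- by exists 0; rewrite ?scale0r.
- exact: w_neq0.
by move=> _ _ [a _ ->] [b _ ->]; rewrite subr0 -scalerBl det2Zr det2xx mulr0.
Qed.

Lemma rays_arrangement :
  rays arrangement_fan = [set C | exists k, C = ray (w k)].
Proof.
apply/seteqP; split => C; last first.
  move=> [k ->]; split; last exact: ray_dim.
  by exists (w k); rewrite // cell_w.
move=> [[x _ <-] dx].
have [x0|x0] := eqVneq x 0.
  have [y [z [+ +]]] := has_dim1_neq dx.
  by rewrite x0 cell0 => -> ->; rewrite eqxx.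
have [k hk] : exists k, det2 (w k) x = 0.
  apply: contrapT => h; apply: (generic_dim _ dx) => k.
  by apply/eqP => hk; apply: h; exists k.
have [l [c [c0 ->]]] := ray_of_det2_eq0 x0 hk.
by exists l; rewrite cell_scale // cell_w.
Qed.

(** The face is the cell of a relative interior point: a sum of points of [F], making positive each
    determinant that is positive somewhere on [F]. *)
Lemma face_cell x F : face (cell x) F -> exists y, F = cell y.
Proof.
move=> [[p Fp] [u Fu]].
have hu y : cell x y -> dot u y <= 0.
  move=> xy; move: Fp; rewrite Fu => -[xp hp].
  (* The maximum reached at [p] is not exceeded at [p + y], again in the cone. *)
  have := hp _ (cellD xp xy); rewrite dotDr.
  by rewrite gerDl.
have FE y : F y <-> cell x y /\ dot u y = 0.
  rewrite Fu; split=> [[xy h]|[xy h]]; split => //; last first.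
    by move=> z xz; rewrite h; exact: hu.
  by apply/eqP; rewrite eq_le hu //= -(dot0r u); apply: h; exact: cell0r.
have F0 : F 0 by apply/FE; split; [exact: cell0r|rewrite dot0r].
(* The default 0 belongs to [F], so the sum stays in [F] in every case. *)
pose g k := xget 0 [set z | F z /\ 0 < det2 (w k) z].
have Fg k : F (g k) by rewrite /g; case: xgetP => [z _ []|].
pose y := \sum_k g k.
have Fy : F y.
  rewrite /y; elim/big_ind : _ => // a b /FE[xa a0] /FE[xb b0].
  by apply/FE; split; [exact: cellD|rewrite dotDr a0 b0 addr0].
exists y; apply/seteqP; split => z; last first.
  move=> yz; have /FE[xy y0] := Fy; apply/FE.
  have xz := cell_trans xy yz; split => //; apply/eqP.
  rewrite eq_le hu //=.
  (* Only the half-planes containing [x] constrain [cell x]; the values 1 and 0 make the other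
     indices trivial. Then [y - e *: z] stays in [cell x], where [u] is nonpositive, which gives
     [0 <= dot u z]. *)
  have [k|k|e e0 he] := small_factor
    (f := fun k => if 0 <= det2 (w k) x then det2 (w k) y else 1)
    (g := fun k => if 0 <= det2 (w k) x then det2 (w k) z else 0).
  - by case: ifPn => // /xy.
  - by case: ifPn => // _; apply: cell_eq0.
  have : cell x (y - e *: z).
    move=> k h; have := he k; rewrite h det2Br det2Zr subr_ge0.
    by apply: le_trans; rewrite ler_wpM2l ?ler_norm ?ltW.
  by move/hu; rewrite dotBr y0 sub0r oppr_le0 dotZr pmulr_rge0.
move=> Fz k hk; rewrite leNgt; apply/negP => zk.
have [k' ek] := w_opp k.
have zk' : 0 < det2 (w k') z by rewrite ek det2Nl oppr_gt0.
have xk' : 0 < det2 (w k') x.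
  rewrite ltNge; apply/negP; have /FE[xz _] := Fz.
  by move/(cell_le0 xz); rewrite leNgt zk'.
have gk' : 0 < det2 (w k') (g k').
  rewrite /g; case: xgetP => [_ _ []//|h].
  by exfalso; apply: (h z).
have : 0 < det2 (w k') y.
  rewrite /y det2_sumr (bigD1 k') //= ltr_pwDl // sumr_ge0 // => l _.
  by have /FE[xl _] := Fg l; apply: xl; exact: ltW.
by rewrite ek det2Nl oppr_gt0 ltNge hk.
Qed.

(** Sum the functionals of the half-planes that contain [y] but not [x]. Each is nonpositive on
    [cell x], so the sum vanishes only where all of them do, which is where the remaining
    constraints of [cell y] hold. *)
Lemma face_cellI x y : face (cell x) (cell x `&` cell y).
Proof.
split; first by exists 0; split; exact: cell0r.
pose Q k := (det2 (w k) x < 0) && (0 <= det2 (w k) y).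
exists (\sum_(k | Q k) rot (w k)).
have dE z : dot (\sum_(k | Q k) rot (w k)) z = \sum_(k | Q k) det2 (w k) z.
  by rewrite dot_suml; under eq_bigr do rewrite dot_rot.
have Qle z k : cell x z -> Q k -> det2 (w k) z <= 0.
  by move=> xz /andP[h _]; apply: cell_le0 xz (ltW h).
apply/seteqP; split => z [xz].
- move=> yz; split => // t xt; rewrite !dE [leRHS]big1.
    by apply: sumr_le0 => k; exact: Qle.
  move=> k Qk; apply/eqP; rewrite eq_le Qle //=.
  by move: Qk => /andP[_]; exact: yz.
- move=> h; split => // k yk.
  have [/xz //|xk] := leP 0 (det2 (w k) x).
  have Qk : Q k by rewrite /Q xk yk.
  have := h 0 (@cell0r x); rewrite dot0r dE (bigD1 k) //= => {}h.
  have : \sum_(i | Q i && (i != k)) det2 (w i) z <= 0.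
    by apply: sumr_le0 => l /andP[Ql _]; exact: Qle.
  by move=> h'; move: h; rewrite -subr_ge0; lra.
Qed.

(** A cell depends only on the set of [k] with [0 <= det2 (w k) x]. *)
Lemma arrangement_finite : finite_set arrangement_fan.
Proof.
pose cellS (s : {set T}) : set plane :=
  [set y | forall k, k \in s -> 0 <= det2 (w k) y].
apply: (@sub_finite_set _ _ (range cellS)); last first.
  exact/finite_image/finite_finset.
move=> _ [x _ <-]; exists [set k | 0 <= det2 (w k) x]%SET => //.
by apply/seteqP; split => y h k; have := h k; rewrite inE.
Qed.

Lemma arrangement_polyhedral : polyhedral_fan arrangement_fan.
Proof.
split; first exact: arrangement_finite.
- move=> _ [x _ <-].
  exists [seq rot (w k) | k <- enum T & 0 <= det2 (w k) x].
  apply/seteqP; split => y h.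
    move=> u /mapP[k + ->]; rewrite mem_filter => /andP[/h + _].
    by rewrite dot_rot.
  move=> k kx; rewrite -dot_rot; apply: h; apply/mapP; exists k => //.
  by rewrite mem_filter kx mem_enum.
- by move=> _ F [x _ <-] /face_cell[y ->]; exists y.
- move=> _ _ [x _ <-] [y _ <-]; split; first exact: face_cellI.
  by rewrite setIC; exact: face_cellI.
Qed.

Lemma arrangement_complete : complete_fan arrangement_fan.
Proof.
by apply/seteqP; split => // x _; exists (cell x); [exists x|exact: cell_refl].
Qed.

Lemma generic_maximal x : generic x -> maximal_cone arrangement_fan (cell x).
Proof.
move=> gx; split; first by exists x.
move=> _ [y _ <-] /(_ x (@cell_refl x)) yx; apply/seteqP; split.
  apply: cell_trans => k h; rewrite leNgt; apply/negP => /ltW yk.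
  have := cell_le0 yx yk; rewrite le_eqVlt (negbTE (gx k)) /=.
  by rewrite ltNge h.
exact: cell_trans.
Qed.

Lemma generic_cell_gt0 x y k : generic y -> cell x y ->
  0 <= det2 (w k) x -> 0 < det2 (w k) y.
Proof. by move=> gy xy /xy; rewrite le_eqVlt eq_sym (negbTE (gy k)). Qed.

Lemma generic_cell_sym x y : generic x -> generic y -> cell x y -> cell y x.
Proof.
move=> gx gy xy k; rewrite !leNgt; apply: contra => /ltW/(cell_le0 xy).
by rewrite le_eqVlt (negbTE (gy k)).
Qed.

Lemma interior_cell x y :
  interior (cell x) y <-> generic y /\ cell x y /\ generic x.
Proof.
split=> [iy|[gy [xy gx]]]; last first.
  have h : forall k, 0 <= det2 (w k) x -> 0 < dot (rot (w k)) y.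
    by move=> k h; rewrite dot_rot; exact: generic_cell_gt0 h.
  have := nbhs_dot_gt0 (Q := fun k => 0 <= det2 (w k) x) h.
  apply: filterS => z hz k hk.
  by rewrite -dot_rot ltW // hz.
have xy : cell x y := nbhs_singleton iy.
have gt k : 0 <= det2 (w k) x -> 0 < det2 (w k) y.
  (* A short step along [- rot (w k)] lowers [det2 (w k)] and stays in the cell, so the value at [y]
     was positive. *)
  move=> hk; have [e e0 he] := nbhs_dir (- rot (w k)) iy.
  have := he k hk; rewrite det2Dr det2Zr det2Nr.
  have : det2 (w k) (rot (w k)) = dot (w k) (w k).
    by rewrite dotE /det2 !mxE /=; ring.
  by move=> ->; have := mulr_gt0 e0 (dot_gt0 (w_neq0 k)); lra.
have gy := genericI gt.
split => //; split => // k; apply/eqP => xk.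
by have := gt k; rewrite xk lexx (cell_eq0 xy xk) ltxx => /(_ isT).
Qed.

Lemma same_maximal_cone a b :
  (exists C, [/\ maximal_cone arrangement_fan C, interior C a & interior C b])
  <-> [/\ generic a, generic b & cell a b].
Proof.
split=> [[_ [[[x _ <-] _] ia ib]]|[ga gb ab]].
  move: ia ib => /interior_cell[ga [xa gx]] /interior_cell[gb [xb _]].
  split => //; apply: cell_trans xb.
  exact: generic_cell_sym.
exists (cell a); split; first exact: generic_maximal.
  by apply/interior_cell; split => //; split => //; exact: cell_refl.
by apply/interior_cell.
Qed.

Lemma genericD x y : generic x -> cell x y -> generic (x + y).
Proof.
move=> gx xy; apply: (@genericI x) => k hk.
by rewrite det2Dr ltr_wpDr ?xy // lt_def gx.
Qed.

Lemma generic_neq0 x : inhabited T -> generic x -> x != 0.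
Proof. by move=> [k] /(_ k); apply: contra => /eqP->; rewrite det2x0. Qed.

(* [dot a (w k) / det2 a (w k)] is the cotangent of the angle from [a] to
   [w k], so its extrema are reached at the two walls of [cell a]. *)
Lemma cell_walls a : a != 0 -> generic a ->
  (exists k, 0 < det2 a (w k) /\ cell a (w k)) /\
  (exists k, det2 a (w k) < 0 /\ cell a (w k)).
Proof.
move=> a0 ga.
have ga' k : 0 <= det2 (w k) a -> det2 a (w k) < 0.
  by move=> h; rewrite det2N oppr_lt0 lt_def ga.
have aa := dot_gt0 a0.
have [k0 hk0] : exists k, 0 < det2 a (w k).
  have [k hk] := w_det2_gt0 a0; have [k' ek] := w_opp k.
  by exists k'; rewrite ek det2Nr -det2N.
pose Q k := 0 < det2 a (w k); pose F k := dot a (w k) / det2 a (w k).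
split.
- case: (@arg_maxP _ _ _ k0 Q F hk0) => k; rewrite /Q /F => hk maxk.
  exists k; split => // m /ga' hm; have [m' em] := w_opp m.
  have hm' : 0 < det2 a (w m') by rewrite em det2Nr oppr_gt0.
  have /= := maxk m' hm'; rewrite ler_pdivrMr // mulrAC ler_pdivlMr // => h.
  rewrite -(pmulr_rge0 _ aa) det2_lagrange.
  by move: h; rewrite em dotNr det2Nr; lra.
- case: (@arg_minP _ _ _ k0 Q F hk0) => k; rewrite /Q /F => hk mink.
  have [k' ek] := w_opp k; exists k'; rewrite ek det2Nr oppr_lt0; split => //.
  move=> m /ga' hm; have [m' em] := w_opp m.
  have hm' : 0 < det2 a (w m') by rewrite em det2Nr oppr_gt0.
  have /= := mink m' hm'; rewrite ler_pdivrMr // mulrAC ler_pdivlMr // => h.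
  rewrite -(pmulr_rge0 _ aa) det2Nr mulrN det2_lagrange.
  by move: h; rewrite em dotNr det2Nr; lra.
Qed.

(** Cramer's rule writes [b] as a nonnegative combination of [w k] and [w l], one on each side of
    [a], both in the cell. *)
Lemma cell_between a b k l : 0 < det2 a (w k) -> cell a (w k) ->
  det2 a (w l) < 0 -> cell a (w l) ->
  det2 (w k) b <= 0 -> 0 <= det2 (w l) b -> cell a b.
Proof.
move=> hk ak hl al kb lb.
have kl : det2 (w k) (w l) < 0.
  rewrite lt_neqAle (cell_le0 al) ?andbT; last first.
    by rewrite det2N oppr_le0 ltW.
  (* Parallel walls would be opposite, and [cell a] would contain a line, contrary to the spanning
     hypothesis. *)
  apply/eqP => /(det2_eq0 (w_neq0 k)); move: (_ / _) => c el.
  have c0 : c < 0 by move: hl; rewrite el det2Zr pmulr_llt0.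
  have [m hm] := w_det2_gt0 (w_neq0 k).
  have am : 0 <= det2 (w m) a.
    by rewrite leNgt; apply/negP => /ltW /(cell_le0 ak); rewrite leNgt hm.
  by have := al m am; rewrite el det2Zr pmulr_lge0 // leNgt c0.
rewrite (cramerV b (ltr0_neq0 kl)).
apply: cellD; apply: cellZ => //; rewrite mulr_le0 ?invr_le0 ?(ltW kl) //.
by rewrite det2N oppr_le0.
Qed.

End Arrangement.

(** * A complete fan is determined by its rays *)

Section FanUniqueness.
Variables (R : realType) (T : finType) (w : T -> 'rV[R]_2).
Hypothesis w_neq0 : forall k, w k != 0.
Hypothesis w_opp : forall k, exists k', w k' = - w k.
Hypothesis w_span : forall u, u != 0 -> exists k, dot u (w k) != 0.
Local Notation plane := 'rV[R]_2.
Implicit Types (u x y z : plane) (c : R) (s : seq plane).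

Lemma index_inhabited : inhabited T.
Proof.
by have [k _] := w_span (delta_mx0_neq0 R); exists.
Qed.

Definition halfplanes s : set plane :=
  [set x | forall u, u \in s -> 0 <= dot u x].

(** Full-dimensionality of a cone, through two independent members. *)
Definition wide (C : set plane) := exists y z, [/\ C y, C z & det2 y z != 0].

(** Interior points of [halfplanes s]; zero vectors of [s] are exempt, since no point makes them
    positive. *)
Definition strict s x := forall u, u \in s -> u != 0 -> 0 < dot u x.

Lemma halfplanes0 s : halfplanes s 0.
Proof. by move=> u _; rewrite dot0r. Qed.

Lemma strict_in s x : strict s x -> halfplanes s x.
Proof.
move=> sx u us; have [->|u0] := eqVneq u 0; first by rewrite dot0l.
by rewrite ltW // sx.
Qed.

Lemma strict_eps s x y : strict s x ->
  exists2 e, 0 < e & halfplanes s (x - e *: y).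
Proof.
move=> sx.
have [i|i h|e e0 he] := small_factor (T := 'I_(size s))
    (f := fun i => dot s`_i x) (g := fun i => dot s`_i y).
- exact: (strict_in sx (mem_nth 0 (ltn_ord i))).
- have [->|u0] := eqVneq s`_i 0; first by rewrite dot0l.
  by have := sx _ (mem_nth 0 (ltn_ord i)) u0; rewrite h ltxx.
exists e => // u /(nthP 0)[i ilt <-]; have := he (Ordinal ilt).
rewrite dotBr dotZr subr_ge0; apply: le_trans.
by rewrite ler_wpM2l ?ler_norm ?ltW.
Qed.

(** The sum of two independent members works: a nonzero functional of [s] vanishing on it would
    vanish on both. *)
Lemma wide_strict s : wide (halfplanes s) -> exists x, strict s x.
Proof.
move=> [y [z [sy sz yz]]]; exists (y + z) => u us u0.
rewrite lt_def dotDr addr_ge0 ?sy ?sz // andbT.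
apply: contra yz; rewrite paddr_eq0 ?sy ?sz // => /andP[/eqP hy /eqP hz].
by apply/eqP; exact: dot_det2_eq0 u0 hy hz.
Qed.

Variable Delta : set (set plane).
Hypothesis fanD : polyhedral_fan Delta.
Hypothesis completeD : complete_fan Delta.
Hypothesis raysD : rays Delta = [set C | exists k, C = ray (w k)].

Lemma fan_ray k : Delta (ray (w k)).
Proof.
suff : rays Delta (ray (w k)) by case.
by rewrite raysD; exists k.
Qed.

(** If nonzero, such a cone has dimension 1, so it is among the given rays. *)
Lemma thin_cone C : Delta C -> ~ wide C ->
  C = [set 0] \/ exists k, C = ray (w k).
Proof.
move=> DC thin; have [_ polyD _ _] := fanD.
have [s Cs] := polyD C DC.
have C0 : C 0 by rewrite Cs; exact: halfplanes0.
have [[z [Cz z0]]|h] := pselect (exists z, C z /\ z != 0); last first.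
  left; apply/seteqP; split => z /=; last by move=> ->.
  by move=> Cz; apply/eqP; apply: contrapT => /negP z0; apply: h; exists z.
right; suff : rays Delta C by rewrite raysD.
split => //; apply: (has_dim1I Cz C0) => // a b Ca Cb.
have col y : C y -> det2 z y = 0.
  by move=> Cy; apply: contrapT => /eqP zy; apply: thin; exists z, y.
by rewrite subr0 det2Br !col // subrr.
Qed.

Lemma thin_nongeneric C x : Delta C -> ~ wide C -> C x -> ~ generic w x.
Proof.
move=> DC thin Cx gx; have [C0|[k Ck]] := thin_cone DC thin.
- have [k] := index_inhabited.
  by move: Cx (gx k); rewrite C0 => ->; rewrite det2x0 eqxx.
- by apply: (generic_ray (k := k) gx); rewrite -Ck.
Qed.

(** A boundary line through [x] would cut out a face, a thin cone of [Delta], and thin cones contain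
    no generic point. *)
Lemma generic_strict s x : Delta (halfplanes s) -> halfplanes s x ->
  generic w x -> strict s x.
Proof.
move=> Ds sx gx u us u0; rewrite lt_def sx // andbT; apply/eqP => ux.
pose F := [set z | halfplanes s z /\ dot u z = 0].
have DF : Delta F.
  have [_ _ faceD _] := fanD; apply: faceD Ds _; split; first by exists x.
  exists (- u); apply/seteqP; split => z [sz h]; split => //.
    by move=> y sy; rewrite !dotNl h oppr0 oppr_le0 sy.
  have := h 0 (@halfplanes0 s); rewrite dot0r dotNl oppr_ge0 => uz.
  by apply/eqP; rewrite eq_le uz sz.
apply: (thin_nongeneric DF _ _ gx); last by split.
move=> [y [z [[_ hy] [_ hz]]]].
by rewrite (dot_det2_eq0 u0 hy hz) eqxx.
Qed.

(** Otherwise [x] lies on some [ray (w l)], which meets the cone in a face. A face through an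
    interior point is the whole cone, so the cone would lie in a ray. *)
Lemma strict_generic s x : Delta (halfplanes s) -> wide (halfplanes s) ->
  strict s x -> generic w x.
Proof.
move=> Ds [y [z [sy sz yz]]] sx k; apply/eqP.
move=> /(nongeneric_ray w_neq0 w_opp)[l lx].
have [_ _ _ interD] := fanD.
have [[_ [u Fu]] _] := interD _ _ Ds (fan_ray l).
have sx' := strict_in sx.
have max_x a : halfplanes s a -> dot u a <= dot u x.
  have : (halfplanes s `&` ray (w l)) x by [].
  by rewrite Fu => -[_]; exact.
have ray_s a : halfplanes s a -> ray (w l) a.
  move=> sa; suff : (halfplanes s `&` ray (w l)) a by case.
  rewrite Fu; split => // b /max_x /le_trans; apply.
  (* Backing off from [x] along [a] gives [0 <= dot u a], doubling [x] gives [dot u x <= 0]; hence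
     [a] is a maximizer as well. *)
  have [e e0 /max_x] := strict_eps a sx.
  rewrite dotBr dotZr gerBl pmulr_rge0 // => ua.
  suff : dot u (2 *: x) <= dot u x by rewrite dotZr; lra.
  by apply: max_x => v vs; rewrite dotZr mulr_ge0 // sx'.
have [a _ ya] := ray_s y sy; have [b _ zb] := ray_s z sz.
by move: yz; rewrite ya zb det2Zl det2Zr det2xx !mulr0 eqxx.
Qed.

Lemma generic_segment x y (t : R) : cell w x y -> generic w x -> generic w y ->
  0 <= t <= 1 -> generic w (x + t *: (y - x)).
Proof.
move=> xy gx gy /andP[t0 t1].
have pos k : 0 <= det2 (w k) x -> 0 < det2 (w k) (x + t *: (y - x)).
  move=> hx; have hy := generic_cell_gt0 gy xy hx.
  have {}hx : 0 < det2 (w k) x by rewrite lt_def gx.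
  rewrite det2Dr det2Zr det2Br.
  have [t1'|t1'] := eqVneq t 1; first by rewrite t1'; lra.
  have : t < 1 by rewrite lt_neqAle t1'.
  by move=> {}t1; nra.
exact: (@genericI _ _ _ w_opp x).
Qed.

(** Interior points of the cone are generic and its generic points are interior. So the interior
    crosses no line of the arrangement, and a segment of generic points starting in the cone never
    leaves it. *)
Lemma wide_cell s x : Delta (halfplanes s) -> wide (halfplanes s) ->
  strict s x -> halfplanes s = cell w x.
Proof.
move=> Ds ws sx; have gx := strict_generic Ds ws sx.
apply/seteqP; split => y.
- move=> sy k hk; rewrite leNgt; apply/negP => yk.
  have xk : 0 < det2 (w k) x by rewrite lt_def gx.
  (* The coefficient puts this strict point on the line of [w k]. *)
  have /(strict_generic Ds ws)/(_ k) :
      strict s (x + (det2 (w k) x / - det2 (w k) y) *: y).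
    move=> u us u0; rewrite dotDr dotZr ltr_pwDl ?sx // mulr_ge0 ?sy //.
    by rewrite divr_ge0 ?oppr_ge0 // ltW.
  rewrite det2Dr det2Zr invrN mulrN mulNr divfK ?subrr ?eqxx //.
  by rewrite lt_eqF.
have gcell z : cell w x z -> generic w z -> halfplanes s z.
  move=> xz gz; apply: contrapT => nsz.
  have [i0 hi0] : exists i : 'I_(size s), dot s`_i z < 0.
    apply: contrapT => h; apply: nsz => u /(nthP 0)[i ilt <-].
    by rewrite leNgt; apply/negP => hi; apply: h; exists (Ordinal ilt).
  (* Parameter at which the segment from [x] to [z] crosses the zero line of the [i]-th functional;
     the least one marks the exit from the cone. *)
  pose F (i : 'I_(size s)) := dot s`_i x / (dot s`_i x - dot s`_i z).
  have xpos (i : 'I_(size s)) : dot s`_i z < 0 -> 0 < dot s`_i x.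
    move=> hi; apply: sx; first exact: (mem_nth 0 (ltn_ord i)).
    by apply: contraTneq hi => ->; rewrite dot0l ltxx.
  pose Q := fun i : 'I_(size s) => dot s`_i z < 0.
  case: (@arg_minP _ _ _ i0 Q F hi0) => i hi mini.
  have xi := xpos i hi.
  have di : 0 < dot s`_i x - dot s`_i z by rewrite /Q in hi; lra.
  have ti : 0 <= F i <= 1.
    rewrite /F divr_ge0 ?(ltW xi) ?(ltW di) //= ler_pdivrMr // mul1r.
    by rewrite /Q in hi; lra.
  have gc := generic_segment xz gx gz ti.
  have sc : halfplanes s (x + F i *: (z - x)).
    move=> u /(nthP 0)[j jlt <-]; rewrite dotDr dotZr dotBr.
    have := mini (Ordinal jlt); rewrite /Q /=; have := xpos (Ordinal jlt).
    have [hj _ _|hj /(_ isT) xj /(_ isT)] := leP 0 (dot s`_j z).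
      have := strict_in sx (mem_nth 0 jlt).
      by move: ti => /andP[]; nra.
    rewrite {2}/F /= ler_pdivlMr; last by rewrite /= in xj; lra.
    by lra.
  have := generic_strict Ds sc gc (mem_nth 0 (ltn_ord i)).
  rewrite dotDr dotZr dotBr -opprB mulrN /F divfK ?gt_eqF // subrr ltxx => h.
  suff /h : s`_i != 0 by [].
  by apply: contraTneq hi => h0; rewrite /Q h0 dot0l ltxx.
move=> xy u us; rewrite leNgt; apply/negP => uy.
have ux := strict_in sx us.
(* This makes [dot u (y + e *: x)] equal to [- e], while the shifted point is generic and in the
   cell, so the generic case applies. The 1 keeps the denominator positive. *)
pose e := - dot u y / (1 + dot u x).
have d0 : 0 < 1 + dot u x by lra.
have e0 : 0 < e by rewrite divr_gt0 ?oppr_gt0.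
have cyx : cell w x (y + e *: x).
  by apply: cellD => //; apply: cellZ; [exact: ltW|exact: cell_refl].
have pos k : 0 <= det2 (w k) x -> 0 < det2 (w k) (y + e *: x).
  move=> hk; rewrite det2Dr det2Zr ltr_wpDl ?xy // mulr_gt0 //.
  by rewrite lt_def gx.
have gyx := genericI w_opp pos.
have := gcell _ cyx gyx u us.
have ee : e * (1 + dot u x) = - dot u y by rewrite /e divfK ?gt_eqF.
by rewrite dotDr dotZr; nra.
Qed.

(** Wide cones are cells of generic points, thin ones are 0 or given rays. Conversely, completeness
    puts each generic point in a cone of [Delta], necessarily wide; the rays are given, and 0 is the
    common face of two opposite rays. *)
Theorem fan_unique : Delta = arrangement_fan w.
Proof.
have [_ polyD faceD interD] := fanD.
apply/seteqP; split.
  move=> C DC; have [wC|thin] := pselect (wide C).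
    have [s Cs] := polyD C DC; rewrite -/(halfplanes s) in Cs.
    rewrite Cs in DC wC *; have [x sx] := wide_strict wC.
    by exists x => //; rewrite (wide_cell DC wC sx).
  have [->|[k ->]] := thin_cone DC thin.
    by exists 0; rewrite ?cell0.
  by exists (w k); rewrite ?cell_w.
move=> _ [x _ <-].
have [->|x0] := eqVneq x 0.
  have [k] := index_inhabited.
  have [k' ek] := w_opp k.
  rewrite cell0 //; have -> : [set 0] = ray (w k) `&` ray (w k').
    apply/seteqP; split => y /=.
      by move=> ->; split; exists 0; rewrite ?scale0r.
    move=> [[a a0 ->] [b b0 /eqP]]; rewrite ek scalerN -addr_eq0 -scalerDl.
    rewrite scaler_eq0 (negbTE (w_neq0 k)) orbF paddr_eq0 // => /andP[/eqP-> _].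
    by rewrite scale0r.
  by apply: faceD (fan_ray k) _; have [] := interD _ _ (fan_ray k) (fan_ray k').
have [gx|ngx] := pselect (generic w x); last first.
  have [k hk] : exists k, det2 (w k) x = 0.
    apply: contrapT => h; apply: ngx => k.
    by apply/eqP => hk; apply: h; exists k.
  have [l [c [c0 ->]]] := ray_of_det2_eq0 w_neq0 w_opp x0 hk.
  by rewrite cell_scale // cell_w //; exact: fan_ray.
have : (\bigcup_(C in Delta) C) x by rewrite completeD.
move=> [C DC Cx]; have wC : wide C.
  by apply: contrapT => thin; exact: thin_nongeneric DC thin Cx gx.
have [s Cs] := polyD C DC; rewrite -/(halfplanes s) in Cs.
rewrite Cs in DC wC Cx; rewrite -(wide_cell DC wC) //.
exact: generic_strict.
Qed.

End FanUniqueness.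

(** * Cones over convex sets and Caratheodory's theorem *)

Section ConvexCones.
Variable R : realType.
Local Notation plane := 'rV[R]_2.
Implicit Types (A B : set plane) (u x y z : plane).

Definition convex A := forall x y (s t : R), A x -> A y ->
  0 <= s -> 0 <= t -> s + t = 1 -> A (s *: x + t *: y).

(** One-term version of [cone], equal to it on nonempty convex sets. The cones K(F,G) are
    [scaled (set_diff F G)]. *)
Definition scaled A : set plane :=
  [set x | exists (c : R) p, [/\ 0 <= c, A p & x = c *: p]].

Definition set_diff A B : set plane :=
  [set x | exists p q, [/\ A p, B q & x = p - q]].

Lemma convex_diff A B : convex A -> convex B -> convex (set_diff A B).
Proof.
move=> cA cB _ _ s t [p [q [Ap Bq ->]]] [p' [q' [Ap' Bq' ->]]] s0 t0 st.
exists (s *: p + t *: p'), (s *: q + t *: q').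
split; [exact: cA|exact: cB|].
by rewrite !scalerBr addrACA -opprD.
Qed.

Lemma scaled_sub A x : A x -> scaled A x.
Proof. by exists 1, x; rewrite scale1r. Qed.

Lemma scaledZ A c x : 0 <= c -> scaled A x -> scaled A (c *: x).
Proof.
move=> c0 [d [p [d0 Ap ->]]].
by exists (c * d), p; rewrite scalerA mulr_ge0.
Qed.

Lemma scaledD A x y : convex A -> scaled A x -> scaled A y ->
  scaled A (x + y).
Proof.
move=> cA [c [p [c0 Ap ->]]] [d [q [d0 Aq ->]]].
have [cd0|cd0] := eqVneq (c + d) 0.
  move/eqP: cd0; rewrite paddr_eq0 // => /andP[/eqP-> /eqP->].
  by exists 0, p; rewrite !scale0r addr0.
exists (c + d), ((c / (c + d)) *: p + (d / (c + d)) *: q).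
split; first exact: addr_ge0.
  by apply: cA => //; rewrite ?divr_ge0 ?addr_ge0 // -mulrDl divff.
by rewrite scalerDr !scalerA !(mulrCA (c + d)) !divff // !mulr1.
Qed.

Lemma cone_scaled A : convex A -> A !=set0 -> cone A = scaled A.
Proof.
move=> cA [p Ap]; apply/seteqP; split => x.
- move=> [k [t [y [t0 Ay ->]]]]; elim/big_ind: _.
  + by exists 0, p; rewrite scale0r.
  + by move=> a b; exact: scaledD.
  + by move=> i _; exists (t i), (y i).
- move=> [c [q [c0 Aq ->]]].
  by exists 1%N, (fun=> c), (fun=> q); rewrite big_ord1.
Qed.

(** With product weights, summing out one index leaves the combination over the other. *)
Lemma diff_combo (I : finType) (c d : I -> R) (v : I -> plane) :
  \sum_i c i = 1 -> \sum_i d i = 1 ->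
  \sum_i c i *: v i - \sum_i d i *: v i =
  \sum_p (c p.1 * d p.2) *: (v p.1 - v p.2).
Proof.
move=> c1 d1; rewrite -(pair_bigA _ (fun i j => (c i * d j) *: (v i - v j))) /=.
under [RHS]eq_bigr => i _.
  under eq_bigr do rewrite scalerBr.
  rewrite sumrB; over.
rewrite sumrB; congr (_ - _).
  by apply: eq_bigr => i _; rewrite -scaler_suml -mulr_sumr d1 mulr1.
rewrite exchange_big; apply: eq_bigr => j _ /=.
by rewrite -scaler_suml -mulr_suml c1 mul1r.
Qed.

(* Caratheodory's theorem in the plane, with the coefficients read off from
   determinants: among the [w k] to the left of [a], pick one with the smallest
   angle to [a]. *)
Lemma caratheodory (T : finType) (c : T -> R) (w : T -> plane) a :
  (forall k, 0 <= c k) -> a = \sum_k c k *: w k -> a != 0 ->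
  (forall k, 0 < c k -> w k != 0 -> det2 a (w k) != 0) ->
  exists i j, [/\ 0 < c i, 0 < c j, 0 < det2 a (w i), det2 a (w j) < 0
    & det2 (w i) (w j) < 0].
Proof.
move=> c0 ae a0 gen.
pose g k := det2 a (w k); pose h k := dot a (w k).
have sg : \sum_k c k * g k = 0.
  rewrite -[RHS](det2xx a) [X in _ = det2 _ X]ae det2_sumr.
  by apply: eq_bigr => k _; rewrite det2Zr.
have sh : \sum_k c k * h k = dot a a.
  rewrite [X in _ = dot _ X]ae dot_sumr.
  by apply: eq_bigr => k _; rewrite dotZr.
have aa := dot_gt0 a0.
have cases k : [\/ c k = 0, w k = 0 | 0 < c k /\ g k != 0].
  have [->|ck] := eqVneq (c k) 0; first by constructor 1.
  have [->|wk] := eqVneq (w k) 0; first by constructor 2.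
  have ck0 : 0 < c k by rewrite lt_def ck c0.
  by constructor 3; split => //; exact: gen.
pose Q k := (0 < c k) && (0 < g k).
(* Otherwise the terms of the zero sum [sg] are all nonpositive, hence zero, and every [c k *: w k]
   vanishes, contrary to [a != 0]. *)
have [k0 Qk0] : exists k, Q k.
  apply: contrapT => nQ.
  have le0 k : 0 <= - (c k * g k).
    rewrite oppr_ge0 leNgt; apply/negP => cg; apply: nQ; exists k.
    have ck : 0 < c k.
      rewrite lt_def c0 andbT.
      by apply: contraTneq cg => ->; rewrite mul0r ltxx.
    by rewrite /Q ck -(pmulr_rgt0 _ ck).
  have /eqP : \sum_k - (c k * g k) = 0 by rewrite sumrN sg oppr0.
  rewrite psumr_eq0 // => /allP z.
  move: a0; rewrite ae big1 ?eqxx // => k _.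
  have := z k (mem_index_enum k); rewrite oppr_eq0 mulf_eq0 /=.
  case: (cases k) => [->|->|[ck gk]]; rewrite ?scale0r ?scaler0 //.
  by rewrite (negbTE gk) gt_eqF.
case: (@arg_maxP _ _ _ k0 Q (fun k => h k / g k) Qk0) => i /andP[ci gi] maxi.
(* If no index pairs with [i], each [c k * h k] is at most [h i / g i * (c k * g k)]; summing gives
   [dot a a <= 0]. *)
apply: contrapT => none.
suff : dot a a <= h i / g i * \sum_k c k * g k by rewrite sg mulr0 leNgt aa.
rewrite -sh mulr_sumr; apply: ler_sum => k _; rewrite mulrCA.
case: (cases k) => [->|wk|[ck gk]]; first by rewrite !mul0r.
  by rewrite /h /g wk dot0r det2x0 !mulr0.
rewrite ler_pM2l //; move: gk; rewrite neq_lt => /orP[gk|gk]; last first.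
  by rewrite -ler_pdivrMr //; apply: maxi; rewrite /Q ck gk.
rewrite mulrAC ler_pdivlMr // leNgt; apply/negP => hk; apply: none.
exists i, k; split => //.
by rewrite -(pmulr_rlt0 _ aa) det2_lagrange subr_lt0.
Qed.

End ConvexCones.

(** * Vertices, edges and distances of a symmetric polygon *)

Section Polygon.
Variables (R : realType) (I : finType) (P : set 'rV[R]_2) (v : I -> 'rV[R]_2).
Hypothesis vertP : polygon_with_vertices P v.
Hypothesis symP : centrally_symmetric P.
Local Notation plane := 'rV[R]_2.
Implicit Types (F G : set plane) (u l x y z : plane).

Lemma poly_v i : P (v i).
Proof. by case: vertP => _ -> _ _; apply: sub_gen_smallest; exists i. Qed.

Lemma poly_convex : convex P.
Proof.
case: vertP => _ -> _ _ x y s t Px Py s0 t0 st A [cA vA].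
have s1 : s <= 1 by rewrite -st lerDl.
have := cA x y (Itv01 s0 s1); rewrite !inE => /(_ (Px A (conj cA vA))).
move=> /(_ (Py A (conj cA vA))).
by rewrite (_ : t = 1 - s) // -st addrAC subrr add0r.
Qed.

(** The convex combinations form a convex set containing the vertices. *)
Lemma poly_combo x : P x -> exists c : I -> R,
  [/\ forall i, 0 <= c i, \sum_i c i = 1 & x = \sum_i c i *: v i].
Proof.
pose C : set plane := [set x | exists c : I -> R,
  [/\ forall i, 0 <= c i, \sum_i c i = 1 & x = \sum_i c i *: v i]].
suff sub : conv_hull (range v) `<=` C by case: vertP => _ -> _ _ /sub.
apply: smallest_sub => [y z lam|_ [i _ <-]].
- rewrite !inE => -[c [c0 c1 ->]] [d [d0 d1 ->]].
  exists (fun i => lam%:num * c i + (1 - lam%:num) * d i); split.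
  + have l0 : 0 <= lam%:num by exact: ge0.
    have l1 : lam%:num <= 1 by exact: le1.
    by move=> i; apply: addr_ge0; rewrite mulr_ge0 ?subr_ge0.
  + by rewrite big_split /= -!mulr_sumr c1 d1; ring.
  + rewrite [LHS]/conv /= !scaler_sumr -big_split /=; apply: eq_bigr => i _.
    by rewrite !scalerA -scalerDl.
- exists (fun j => (j == i)%:R); split; first by move=> j; exact: ler0n.
  + by rewrite (bigD1 i) //= eqxx big1 ?addr0 // => j /negbTE->.
  + rewrite (bigD1 i) //= eqxx scale1r big1 ?addr0 // => j /negbTE->.
    by rewrite scale0r.
Qed.

Lemma polyN x : P x -> P (- x).
Proof. by move=> Px; rewrite symP; exists x. Qed.

Lemma poly_dim2 : has_dim P 2.
Proof. by case: vertP. Qed.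

Lemma poly_le u i : (forall k, dot u (v k) <= dot u (v i)) ->
  forall x, P x -> dot u x <= dot u (v i).
Proof.
move=> h x /poly_combo[c [c0 c1 ->]]; rewrite dot_sumr.
rewrite -[leRHS]mul1r -c1 mulr_suml; apply: ler_sum => k _.
by rewrite dotZr ler_wpM2l.
Qed.

Lemma poly_nonflat u i : u != 0 -> exists k, dot u (v k) != dot u (v i).
Proof.
move=> u0; apply: contrapT => h.
have flat k : dot u (v k) = dot u (v i).
  by apply: contrapT => /eqP hk; apply: h; exists k.
have {}flat x : P x -> dot u x = dot u (v i).
  move=> Px; apply/eqP; rewrite eq_le poly_le //=; last first.
    by move=> k; rewrite flat.
  rewrite -lerN2 -!dotNl poly_le // => k.
  by rewrite !dotNl flat.
have [x [y [Px Py]]] := has_dim2_dot poly_dim2 u0.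
by rewrite dotBr !flat // subrr eqxx.
Qed.

Lemma index_neq : exists i j : I, i != j.
Proof.
have [[x Px] _] := poly_dim2.
have [c [_ c1 _]] := poly_combo Px.
have [i _] : exists i : I, True.
  apply: contrapT => h; move: c1; rewrite big1 => [/esym/eqP|i _].
    by rewrite oner_eq0.
  by exfalso; apply: h; exists i.
have [k hk] := poly_nonflat i (delta_mx0_neq0 R).
by exists k, i; apply: contraNneq hk => ->.
Qed.

(** Were the maximum of [u] nonpositive, symmetry would make [u] vanish on [P]: then [P] is flat, or
    [u = 0] and [F] is all of [P], contrary to its dimension. *)
Lemma facetP F : facet P F -> exists u (m : R),
  [/\ 0 < m, F = [set x | P x /\ dot u x = m] & forall x, P x -> dot u x <= m].
Proof.
move=> [[[p Fp] [u Fu]] dF].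
have FE : F = [set x | P x /\ dot u x = dot u p].
  move: Fp; rewrite Fu => -[Pp hp].
  apply/seteqP; split => x [Px h]; split => //.
    by apply/eqP; rewrite eq_le h // hp.
  by move=> y /hp; rewrite h.
have Pp : P p by move: Fp; rewrite Fu => -[].
have lep x : P x -> dot u x <= dot u p.
  by move=> Px; move: Fp; rewrite Fu => -[_]; exact.
exists u, (dot u p); split => //.
rewrite ltNge; apply/negP => p0.
have zero x : P x -> dot u x = 0.
  move=> Px; have := lep _ Px; have := lep _ (polyN Px).
  by rewrite dotNr; lra.
have [u0|u0] := eqVneq u 0.
  have FP x : P x -> F x by move=> Px; rewrite FE; split; rewrite // u0 !dot0l.
  have [x [y [Fx Fy xy]]] := has_dim1_neq dF.
  have r0 : rot (x - y) != 0 by rewrite rot_eq0 subr_eq0.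
  have [a [b [Pa Pb]]] := has_dim2_dot poly_dim2 r0.
  by rewrite dot_rot (has_dim1_det2 dF) ?eqxx //; exact: FP.
have [a [b [Pa Pb]]] := has_dim2_dot poly_dim2 u0.
by rewrite dotBr !zero // subrr eqxx.
Qed.

Lemma facet_convex F : facet P F -> convex F.
Proof.
move=> /facetP[u [m [_ -> _]]] x y s t [Px hx] [Py hy] s0 t0 st; split.
  exact: poly_convex.
by rewrite dotDr !dotZr hx hy -mulrDl st mul1r.
Qed.

(** The defects [m - dot u (v i)] are nonnegative with weighted mean zero, so they vanish wherever
    the weight is positive. *)
Lemma facet_combo F x : facet P F -> F x -> exists c : I -> R,
  [/\ forall i, 0 <= c i, \sum_i c i = 1, x = \sum_i c i *: v i
    & forall i, 0 < c i -> F (v i)].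
Proof.
move=> /facetP[u [m [_ -> le_m]]] [/poly_combo[c [c0 c1 xe]] hx].
exists c; split => // i ci; split; first exact: poly_v.
have : \sum_i c i * (m - dot u (v i)) = 0.
  under eq_bigr do rewrite mulrBr.
  rewrite sumrB -mulr_suml c1 mul1r -hx xe dot_sumr.
  by under [X in _ - X]eq_bigr do rewrite -dotZr; rewrite subrr.
move=> /eqP; rewrite psumr_eq0; last first.
  by move=> k _; rewrite mulr_ge0 // subr_ge0 le_m //; exact: poly_v.
move=> /allP/(_ i (mem_index_enum i)); rewrite mulf_eq0 gt_eqF //= subr_eq0.
by move/eqP.
Qed.

(** The functional supporting [F] has a positive maximum on [P], attained at [p], which bounds every
    admissible scale below by [c]. *)
Lemma dist_facet F a p (c : R) : facet P F -> F p -> 0 <= c ->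
  dist P a (a + c *: p) = c.
Proof.
move=> /facetP[u [m [m0 -> le_m]]] [Pp hp] c0.
pose S := [set t : R | 0 <= t /\ exists2 q, P q & a + c *: p - a = t *: q].
have cS : S c by split => //; exists p; rewrite // addrC addKr.
have lbS : lbound S c.
  move=> t [t0 [q Pq]]; rewrite addrC addKr => /(congr1 (dot u)).
  rewrite !dotZr hp => h; rewrite -(ler_pM2r m0) h.
  by rewrite ler_wpM2l // le_m.
apply/eqP; rewrite eq_le; apply/andP; split.
  by apply: ge_inf => //; exists c.
by apply: lb_le_inf => //; exists c.
Qed.

(** A common point is [c p = a + d q], at distances [c] from 0 and [d] from [a]; equality gives
    [a = c (p - q)]. Conversely, [c p] is such a point. *)
Lemma bis_facets_scaled F G a : facet P F -> facet P G ->
  bis_facets P F G 0 a !=set0 <-> scaled (set_diff F G) a.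
Proof.
move=> fF fG; have [[neF _] _] := fF; have [[neG _] _] := fG.
rewrite /bis_facets (cone_scaled (facet_convex fF) neF).
rewrite (cone_scaled (facet_convex fG) neG); split.
- move=> [z [[bz [x [c [p [c0 Fp ->]]] xz]] [y [d [q [d0 Gq ->]]] yz]]].
  have ez : z = 0 + c *: p by rewrite -xz addrC.
  have ez' : z = a + d *: q by rewrite -yz addrC.
  have cd : c = d.
    rewrite -(dist_facet 0 fF Fp c0) -(dist_facet a fG Gq d0) -ez -ez'.
    exact: bz.
  exists c, (p - q); split => //; first by exists p, q.
  by rewrite scalerBr {2}cd -[c *: p]add0r -ez ez' addrK.
- move=> [c [_ [c0 [p [q [Fp Gq ->]]] ->]]].
  have e : 0 + c *: p = c *: (p - q) + c *: q by rewrite -scalerDr subrK add0r.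
  exists (c *: p); split; first split.
  + rewrite /bis /= -{1}[c *: p]add0r (dist_facet 0 fF Fp c0).
    by rewrite -[c *: p]add0r e (dist_facet _ fG Gq c0).
  + by exists (c *: p); [exists c, p|rewrite addr0].
  + by exists (c *: q); [exists c, q|rewrite addrC -e add0r].
Qed.

Lemma vertex_exposed i : exists u, forall x, P x ->
  dot u x <= dot u (v i) /\ (dot u x = dot u (v i) -> x = v i).
Proof.
have [_ _ vP _] := vertP.
have : vertices P (v i) by rewrite vP; exists i.
move=> [_ [u hu]]; exists u => x Px.
have ui y : P y -> dot u y <= dot u (v i).
  by have : [set v i] (v i) by []; rewrite hu => -[_]; exact.
split; first exact: ui.
move=> e; have : [set v i] x; last by [].
by rewrite hu; split => // y /ui; rewrite e.
Qed.

(* Tilting a functional exposing [v i] towards [l] until it meets another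
   vertex gives the edge at [v i] that rises along [l]; the vertex [v j] keeps
   the tilted functional nonzero. *)
Lemma rising_facet l i j k0 : i != j -> dot l (v i) = dot l (v j) ->
  dot l (v i) < dot l (v k0) ->
  exists F, [/\ facet P F, F (v i), forall x, F x -> dot l (v i) <= dot l x
    & exists2 x, F x & dot l (v i) < dot l x].
Proof.
have [vinj _ _ _] := vertP.
move=> ij lij lk0; have [u0 hu0] := vertex_exposed i.
pose f k := dot u0 (v i) - dot u0 (v k).
pose g k := dot l (v k) - dot l (v i).
have f0 k : 0 <= f k by rewrite subr_ge0; have [] := hu0 _ (poly_v k).
have fpos k : k != i -> 0 < f k.
  move=> ki; rewrite lt_def f0 andbT subr_eq0; apply: contra ki => /eqP e.
  by apply/eqP/vinj; have [_] := hu0 _ (poly_v k); exact.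
pose Q k := 0 < g k.
have Qk0 : Q k0 by rewrite /Q subr_gt0.
case: (@arg_minP _ _ _ k0 Q (fun k => f k / g k) Qk0) => k1.
rewrite /Q => gk1 min1.
set t := f k1 / g k1 in min1.
have k1i : k1 != i by apply: contraTneq gk1 => ->; rewrite /g subrr ltxx.
have t0 : 0 < t by rewrite divr_gt0 // fpos.
pose u := u0 + t *: l.
have uE x : dot u x = dot u0 x + t * dot l x by rewrite dotDl dotZl.
have ule : forall x, P x -> dot u x <= dot u (v i).
  apply: poly_le => k; rewrite !uE.
  have [gk|gk] := ltP 0 (g k).
    by have := min1 k gk; rewrite ler_pdivlMr // /f /g; lra.
  have := f0 k; have : t * g k <= 0 by rewrite pmulr_rle0.
  by rewrite /f /g; lra.
have uk1 : dot u (v k1) = dot u (v i).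
  have : t * g k1 = f k1 by rewrite /t divfK // gt_eqF.
  by rewrite !uE /f /g; lra.
have u_neq0 : u != 0.
  have ji : j != i by rewrite eq_sym.
  have := fpos j ji; rewrite /f subr_gt0 => h.
  apply: contraTneq h => ue; have := uE (v i); have := uE (v j).
  by rewrite ue !dot0l lij -leNgt; lra.
pose F := [set x | P x /\ forall y, P y -> dot u y <= dot u x].
have Fi : F (v i) by split; [exact: poly_v|].
have Fk1 : F (v k1) by split; [exact: poly_v|rewrite uk1].
have Fu x : F x -> dot u x = dot u (v i).
  by move=> [Px hx]; apply/eqP; rewrite eq_le ule // hx //; exact: poly_v.
exists F; split => //.
- split; first by split; [exists (v i)|exists u].
  apply: (has_dim1I Fk1 Fi); first by rewrite (inj_eq vinj).
  move=> a b Fa Fb; apply: (dot_det2_eq0 u_neq0); rewrite dotBr !Fu // subrr //.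
- move=> x Fx; have := Fu x Fx; have [] := hu0 x (proj1 Fx).
  rewrite !uE => h _ e; rewrite -(ler_pM2l t0); lra.
- by exists (v k1) => //; rewrite -subr_gt0.
Qed.

(** Adds the case where no vertex lies above [v i]: then the edge exposed by [l] itself contains
    [v i] and [v j]. *)
Lemma side_facet l i j : i != j -> l != 0 -> dot l (v i) = dot l (v j) ->
  exists F, [/\ facet P F, F (v i), forall x, F x -> dot l (v i) <= dot l x
    & forall k, dot l (v i) < dot l (v k) ->
      exists2 x, F x & dot l (v i) < dot l x].
Proof.
move=> ij l0 lij.
have [[k hk]|h] := pselect (exists k, dot l (v i) < dot l (v k)).
  have [F [fF Fi lF xF]] := rising_facet ij lij hk.
  by exists F; split.
have lk k : dot l (v k) <= dot l (v i).
  by rewrite leNgt; apply/negP => hk; apply: h; exists k.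
have lle := poly_le lk.
pose F := [set x | P x /\ forall y, P y -> dot l y <= dot l x].
have Fi : F (v i) by split; [exact: poly_v|].
have Fj : F (v j) by split; [exact: poly_v|rewrite -lij].
have Fl x : F x -> dot l x = dot l (v i).
  by move=> [Px hx]; apply/eqP; rewrite eq_le lle // hx //; exact: poly_v.
have [vinj _ _ _] := vertP.
exists F; split => //.
- split; first by split; [exists (v i)|exists l].
  apply: (has_dim1I Fi Fj); first by rewrite (inj_eq vinj).
  by move=> a b Fa Fb; apply: (dot_det2_eq0 l0); rewrite dotBr !Fl // subrr.
- by move=> x Fx; rewrite Fl.
- by move=> k; rewrite ltNge lk.
Qed.

(** [F] starts at [v i] on the upper side of [l], [G] at [v j] on the lower side. Some vertex is off
    the line through [v i] and [v j]: if above, [F] leaves that line; if below, [G] does. *)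
Lemma wall_facets l i j : i != j -> l != 0 -> dot l (v i - v j) = 0 ->
  exists F G, [/\ facet P F, facet P G, scaled (set_diff F G) (v i - v j),
    forall x, scaled (set_diff F G) x -> 0 <= dot l x
    & exists2 z, scaled (set_diff F G) z & 0 < dot l z].
Proof.
move=> ij l0 /eqP; rewrite dotBr subr_eq0 => /eqP lij.
have [F [fF Fi lF xF]] := side_facet ij l0 lij.
have ji : j != i by rewrite eq_sym.
have nl0 : - l != 0 by rewrite oppr_eq0.
have lji : dot (- l) (v j) = dot (- l) (v i) by rewrite !dotNl lij.
have [G [fG Gj lG xG]] := side_facet ji nl0 lji.
exists F, G; split => //.
- by apply: scaled_sub; exists (v i), (v j).
- move=> _ [c [_ [c0 [p [q [Fp Gq ->]]] ->]]]; rewrite dotZr mulr_ge0 // dotBr.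
  by have := lF p Fp; have := lG q Gq; rewrite !dotNl; lra.
- have [k] := poly_nonflat i l0; rewrite neq_lt => /orP[hk|hk].
  + have [|y Gy] := xG k; first by rewrite !dotNl ltrN2 -lij.
    rewrite !dotNl ltrN2 => h; exists (v i - y).
      by apply: scaled_sub; exists (v i), y.
    by rewrite dotBr lij subr_gt0.
  + have [x Fx h] := xF k hk; exists (x - v j).
      by apply: scaled_sub; exists x, (v j).
    by rewrite dotBr -lij subr_gt0.
Qed.

End Polygon.

(** * Bisector types and the arrangement of vertex differences *)

Section Bisection.
Variables (R : realType) (I : finType) (P : set 'rV[R]_2) (v : I -> 'rV[R]_2).
Hypothesis vertP : polygon_with_vertices P v.
Hypothesis symP : centrally_symmetric P.
Local Notation plane := 'rV[R]_2.
Implicit Types (F G : set plane) (l a b : plane).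

(** Ordered pairs, so that the differences are nonzero and closed under negation. *)
Definition pair_neq := {p : I * I | p.1 != p.2}.

Definition vdiff (k : pair_neq) : plane := v (val k).1 - v (val k).2.

Local Notation fan_cell := (cell vdiff).
Local Notation fan_generic := (generic vdiff).
Local Notation K F G := (scaled (set_diff F G)).

Lemma vdiff_neq0 k : vdiff k != 0.
Proof.
have [vinj _ _ _] := vertP.
by rewrite subr_eq0 (inj_eq vinj); exact: (valP k).
Qed.

Lemma vdiff_opp k : exists k', vdiff k' = - vdiff k.
Proof.
case: k => -[i j] /= ij; have ji : j != i by rewrite eq_sym.
by exists (exist _ (j, i) ji); rewrite /vdiff opprB.
Qed.

Lemma vdiff_span u : u != 0 -> exists k, dot u (vdiff k) != 0.
Proof.
move=> u0; have [i [_ _]] := index_neq vertP.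
have [k hk] := poly_nonflat vertP i u0.
have ki : k != i by apply: contraNneq hk => ->.
by exists (exist _ (k, i) ki); rewrite /vdiff dotBr subr_eq0.
Qed.

Let generic_nz a : fan_generic a -> a != 0.
Proof. by apply: generic_neq0; exact: index_inhabited vdiff_span. Qed.

(** Expand [a] over differences of vertices of [F] and [G]. Two of these enclose [a], and since no
    line of the arrangement separates [b] from [a], they enclose [b] too. *)
Lemma cell_scaled F G a b : facet P F -> facet P G -> fan_generic a ->
  fan_cell a b -> K F G a -> K F G b.
Proof.
move=> fF fG ga ab; have a0 := generic_nz ga.
move=> [r [_ [r0 [x [y [Fx Gy ->]]] ae]]].
have [c [c0 c1 xe cF]] := facet_combo vertP symP fF Fx.
have [d [d0 d1 ye dG]] := facet_combo vertP symP fG Gy.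
pose e (p : I * I) := r * (c p.1 * d p.2).
have e0 p : 0 <= e p by rewrite !mulr_ge0.
have es : a = \sum_p e p *: (v p.1 - v p.2).
  rewrite ae {1}xe {1}ye diff_combo // scaler_sumr.
  by apply: eq_bigr => p _; exact: scalerA.
have cd p : 0 < e p -> F (v p.1) /\ G (v p.2).
  move=> ep; have [cp|cp] := eqVneq (c p.1) 0.
    by move: ep; rewrite /e cp mul0r mulr0 ltxx.
  have [dp|dp] := eqVneq (d p.2) 0.
    by move: ep; rewrite /e dp !mulr0 ltxx.
  by split; [apply: cF|apply: dG]; rewrite lt_def ?cp ?dp /=.
have gen p : 0 < e p -> v p.1 - v p.2 != 0 -> det2 a (v p.1 - v p.2) != 0.
  move=> _; rewrite subr_eq0 => vp.
  have p12 : p.1 != p.2 by apply: contraNneq vp => ->.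
  by have := ga (exist _ p p12); rewrite det2N oppr_eq0.
have [p [q [ep eq gp gq dpq]]] := caratheodory e0 es a0 gen.
have [Fp Gp] := cd p ep; have [Fq Gq] := cd q eq.
have neq (s : I * I) : det2 a (v s.1 - v s.2) != 0 -> s.1 != s.2.
  by apply: contraNneq => ->; rewrite subrr det2x0.
have p12 := neq p (lt0r_neq0 gp); have q12 := neq q (ltr0_neq0 gq).
have bp : det2 (v p.1 - v p.2) b <= 0.
  apply: (cell_le0 vdiff_opp (k := exist _ p p12) ab).
  by rewrite det2N oppr_le0 ltW.
have bq : 0 <= det2 (v q.1 - v q.2) b.
  by apply: (ab (exist _ q q12)); rewrite /vdiff /= det2N oppr_ge0 ltW.
rewrite (cramerV b (ltr0_neq0 dpq)).
have cK : convex (set_diff F G).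
  have := facet_convex vertP symP fG.
  by apply: convex_diff; exact: (facet_convex vertP symP fF).
apply: scaledD => //; apply: scaledZ.
- by rewrite mulr_le0 ?invr_le0 ?(ltW dpq) // det2N oppr_le0.
- by apply: scaled_sub; exists (v p.1), (v p.2).
- by rewrite mulr_le0 ?invr_le0 ?(ltW dpq).
- by apply: scaled_sub; exists (v q.1), (v q.2).
Qed.

Lemma bis_equivE a b : bis_equiv P 0 a 0 b <->
  forall F G, facet P F -> facet P G -> (K F G a <-> K F G b).
Proof.
have aE := bis_facets_scaled vertP symP a.
have bE := bis_facets_scaled vertP symP b.
split=> h F G fF fG; have := h F G fF fG; have := aE F G fF fG;
  have := bE F G fF fG; tauto.
Qed.

(** Some K(F,G) lies in the half-plane [0 <= dot l] with [vdiff k] on its boundary. It contains [a],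
    hence by equivalence also [b]. *)
Lemma wall_bound a b k l : fan_generic a -> fan_cell a (vdiff k) ->
  dot l (vdiff k) = 0 -> 0 < dot l a -> bis_equiv P 0 a 0 b -> 0 <= dot l b.
Proof.
move=> ga ak lk la /bis_equivE ab.
have l0 : l != 0 by apply: contraTneq la => ->; rewrite dot0l ltxx.
have [F [G [fF fG Kk Kl [z Kz lz]]]] := wall_facets vertP (valP k) l0 lk.
apply: Kl; apply/(ab F G fF fG).
have kz : det2 (vdiff k) z != 0.
  apply/eqP => /(det2_eq0 (vdiff_neq0 k)) ez.
  by move: lz; rewrite ez dotZr lk mulr0 ltxx.
have := cramerV a kz; move: (_ / _) (_ / _) => t s ae.
have t0 : 0 < t by move: la; rewrite ae dotDr !dotZr lk mulr0 add0r pmulr_lgt0.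
have cK : convex (set_diff F G).
  have := facet_convex vertP symP fG.
  by apply: convex_diff; exact: (facet_convex vertP symP fF).
(* The coefficient [s] may be negative. Sliding along the wall makes it nonnegative, so [c] is in
   K(F,G), and stays in the cell, which K(F,G) does not separate. *)
pose c := a + `|s| *: vdiff k.
have ac : fan_cell a (`|s| *: vdiff k) by apply: cellZ.
have gc : fan_generic c by apply: genericD => //; exact: vdiff_opp.
apply: (cell_scaled fF fG gc).
  apply: generic_cell_sym => //; first exact: vdiff_opp.
  by apply: cellD => //; exact: cell_refl.
rewrite /c ae addrAC -scalerDl; apply: scaledD => //; apply: scaledZ => //.
  by rewrite -lerBlDl sub0r -normrN ler_norm.
exact: ltW.
Qed.

Lemma bis_equiv_cell a b : fan_generic a -> bis_equiv P 0 a 0 b ->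
  fan_cell a b.
Proof.
move=> ga ab; have a0 := generic_nz ga.
have [[k [hk ak]] [l [hl al]]] := cell_walls vdiff_opp vdiff_span a0 ga.
apply: (cell_between vdiff_neq0 vdiff_opp vdiff_span hk ak hl al).
- rewrite -oppr_ge0 -dot_rot -dotNl; apply: wall_bound ak _ _ ab => //.
    by rewrite dotNl dot_rot det2xx oppr0.
  by rewrite dotNl dot_rot -det2N.
- rewrite -dot_rot; apply: wall_bound al _ _ ab => //.
    by rewrite dot_rot det2xx.
  by rewrite dot_rot det2N oppr_gt0.
Qed.

(** A point on a ray lies on the boundary of some K(F,G), and an arbitrarily small step against an
    inner vector [z] leaves that cone. *)
Lemma general_position_generic a : general_position P a -> fan_generic a.
Proof.
move=> gpa k; apply/eqP => /(nongeneric_ray vdiff_neq0 vdiff_opp)[m [c c0 ae]].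
have r0 : rot (vdiff m) != 0 by rewrite rot_eq0 vdiff_neq0.
have rm : dot (rot (vdiff m)) (vdiff m) = 0 by rewrite dot_rot det2xx.
have [F [G [fF fG Kk Kl [z Kz lz]]]] := wall_facets vertP (valP m) r0 rm.
have [e e0 /bis_equivE/(_ F G fF fG)[+ _]] := nbhs_dir (- z) gpa.
have Ka : K F G a by rewrite ae; exact: scaledZ.
move=> /(_ Ka) /Kl; rewrite dotDr dotZr dotNr ae dotZr rm mulr0 add0r.
by rewrite pmulr_rge0 // oppr_ge0 leNgt lz.
Qed.

Lemma bis_equiv_generic a b : fan_generic a -> fan_generic b ->
  bis_equiv P 0 a 0 b <-> fan_cell a b.
Proof.
move=> ga gb; split; first exact: bis_equiv_cell.
move=> ab; apply/bis_equivE => F G fF fG; split.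
  exact: cell_scaled.
by apply: cell_scaled => //; apply: generic_cell_sym => //; exact: vdiff_opp.
Qed.

Lemma arrangement_bisection : bisection_fan P (arrangement_fan vdiff).
Proof.
split; first exact: arrangement_polyhedral vdiff_opp.
move=> a b /general_position_generic ga /general_position_generic gb.
rewrite (same_maximal_cone vdiff_neq0 vdiff_opp) bis_equiv_generic //.
by split=> [|[]].
Qed.

Lemma vdiff_rays : [set C | exists k, C = ray (vdiff k)] =
  [set C | exists i j, i != j /\ C = cone [set v i - v j]].
Proof.
apply/seteqP; split => C.
  by move=> [[[i j] ij] ->]; exists i, j; rewrite cone_set1.
by move=> [i [j [ij ->]]]; exists (exist _ (i, j) ij); rewrite cone_set1.
Qed.

End Bisection.

Theorem theorem4p3 (R : realType) (n : nat) (P : set 'rV[R]_2)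
    (v : 'I_(2 * n) -> 'rV[R]_2)
    (vertP : polygon_with_vertices P v) (symP : centrally_symmetric P) :
  exists2 Delta : set (set 'rV[R]_2),
    unique (fun Delta' : set (set 'rV[R]_2) =>
      [/\ polyhedral_fan Delta', complete_fan Delta'
        & rays Delta' =
          [set C | exists i j, i != j /\ C = cone [set v i - v j]]]) Delta
    & bisection_fan P Delta.
Proof.
have w0 := vdiff_neq0 vertP; have wN := @vdiff_opp R _ v.
have wS := vdiff_span vertP.
exists (arrangement_fan (vdiff v)); last exact: arrangement_bisection.
rewrite -vdiff_rays; split.
  split; [exact: arrangement_polyhedral|exact: arrangement_complete|].
  exact: rays_arrangement.
by move=> Delta' [fanD completeD raysD]; rewrite (fan_unique w0 wN wS fanD).
Qed.
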